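(* Let $\alpha,\beta,\theta\in(0,\pi)$, let $V$ be a flat-foldable degree-4 vertex with sector angles $\pi-\alpha,\ \pi-\beta,\ \alpha,\ \beta$ in counterclockwise order, and let $DL(V,\theta)$ be a rotated double-line crease pattern of $V$ with its four folding modes a-I, a-II, b-I, b-II (as defined in the context). For $i=0,1,2,3$ let $S_i$ denote the sum of the fold angles of the two parallel creases of $DL(V,\theta)$ corresponding to the crease $e_i$ of $V$. (1) Among these four folding modes, exactly two, a-I and a-II, correspond to Mode a of $V$, and the other two, b-I and b-II, correspond to Mode b of $V$; that is, along the motion in modes a-I and a-II the angles $(S_0,S_1,S_2,S_3)$ satisfy the Mode a relation of $V$, and in modes b-I and b-II they satisfy the Mode b relation of $V$. (2) Suppose $0<\alpha<\beta<\pi/2$. Then, for each $i$, the set of values taken by $S_i$ over the full motion of the mode is as follows. - Mode a-I: $S_i$ spans $[-2\pi,2\pi]$ if $\beta<\theta<\pi-\alpha$; $S_i$ spans $[-M,M]$ for some $M<\pi$ if ($\theta<\pi-\alpha$ and $\theta<\beta$) or ($\theta>\pi-\alpha$ and $\theta>\beta$). - Mode a-II: $S_i$ spans $[-2\pi,2\pi]$ if $\alpha<\theta<\pi-\beta$; $S_i$ spans $[-M,M]$ for some $M<\pi$ if ($\theta<\pi-\beta$ and $\theta<\alpha$) or ($\theta>\pi-\beta$ and $\theta>\alpha$). - Mode b-I: $S_i$ spans $[-2\pi,2\pi]$ if $\alpha<\theta<\beta$; $S_i$ spans $[-M,M]$ for some $M<\pi$ if ($\theta<\alpha$ and $\theta<\beta$)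 or ($\theta>\alpha$ and $\theta>\beta$). - Mode b-II: $S_i$ spans $[-2\pi,2\pi]$ if $\pi-\beta<\theta<\pi-\alpha$; $S_i$ spans $[-M,M]$ for some $M<\pi$ if ($\theta<\pi-\alpha$ and $\theta<\pi-\beta$) or ($\theta>\pi-\alpha$ and $\theta>\pi-\beta$). (The number $M$ may depend on $\alpha,\beta,\theta$, the mode, and $i$.)
   Context: **Rigid folding.** A crease pattern is a straight-line planar graph on a compact disk; a rigid folded state maps each face isometrically to a planar face in $\mathbb{R}^3$, continuously across creases, and is determined up to rigid motion by the fold angles of the creases (the signed angle between normals of adjacent faces; zero = unfolded). Here self-intersection of the paper is ignored, so fold angles of individual creases range over $[-\pi,\pi]$. **The functions $p,q$.** For $x,y\in(0,\pi)$, $$p(x,y)=\frac{1-\tan\frac x2\tan\frac y2}{1+\tan\frac x2\tan\frac y2},\qquad q(x,y)=\frac{-\tan\frac x2+\tan\frac y2}{\tan\frac x2+\tan\frac y2}.$$ **The vertex $V$ and its modes.** The creases of $V$ are rays from a point in unit directions $e_0,e_1,e_2,e_3$ in counterclockwise order, the counterclockwise angle from $e_i$ to $e_{i+1}$ being $\alpha_i$ (indices mod 4), with $(\alpha_0,\alpha_1,\alpha_2,\alpha_3)=(\pi-\alpha,\pi-\beta,\alpha,\beta)$. With fold angles $\rho_0,\dots,\rho_3$ of $e_0,\dots,e_3$, the two folding modes of $V$ are $$\text{Mode a: }\left(\tan\tfrac{\rho_0}{2},\tan\tfrac{\rho_1}{2},\tan\tfrac{\rho_2}{2},\tan\tfrac{\rho_3}{2}\right)=\bigl(1,\,p(\alpha,\beta),\,1,\,-p(\alpha,\beta)\bigr)\tau,$$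 $$\text{Mode b: }\left(\tan\tfrac{\rho_0}{2},\tan\tfrac{\rho_1}{2},\tan\tfrac{\rho_2}{2},\tan\tfrac{\rho_3}{2}\right)=\bigl(q(\alpha,\beta),\,1,\,-q(\alpha,\beta),\,1\bigr)\tau .$$ A folding mode of $DL(V,\theta)$ corresponds to a mode of $V$ if, along it, the relation defining the latter holds with $\rho_i=S_i$ (at all states where the tangents are finite). **Rotated double-line pattern $DL(V,\theta)$.** Let $P=c_0c_1c_2c_3$ be a convex quadrilateral with vertices in counterclockwise order such that the side $s_i=c_{i-1}c_i$, traversed from $c_{i-1}$ to $c_i$, has direction $e_i$ rotated counterclockwise by $\pi-\theta$. $DL(V,\theta)$ consists of the four sides of $P$ together with, for each $i$, the two parallel rays in direction $e_i$ emanating from $c_{i-1}$ and from $c_i$ (the pair of creases corresponding to $e_i$), restricted to a compact disk containing $P$ in its interior. At $c_i$ the creases, in counterclockwise order, are: $s_i$, the ray of direction $e_i$, the ray of direction $e_{i+1}$, $s_{i+1}$; the sector angles between consecutive ones are $\theta,\alpha_i,\pi-\theta,\pi-\alpha_i$. **Modes of $DL(V,\theta)$.** Let the fold angles at $c_i$ of $s_i$, the ray of direction $e_i$, the ray of direction $e_{i+1}$, and $s_{i+1}$ be $\rho^0,\rho^1,\rho^2,\rho^3$. The vertex $c_i$ folds in mode $+$ if $\left(\tan\frac{\rho^0}{2},\tan\frac{\rho^1}{2},\tan\frac{\rho^2}{2},\tan\frac{\rho^3}{2}\right)=\bigl(1,-p(\theta,\alpha_i),1,p(\theta,\alpha_i)\bigr)\tau$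 for some $\tau$, and in mode $-$ if this vector equals $\bigl(-q(\theta,\alpha_i),1,q(\theta,\alpha_i),1\bigr)\tau$ for some $\tau$. The four folding modes of $DL(V,\theta)$ are the one-parameter rigid folding motions through the flat state in which $(c_0,c_1,c_2,c_3)$ fold in modes: a-I: $(-,+,+,-)$; a-II: $(+,-,-,+)$; b-I: $(+,+,-,-)$; b-II: $(-,-,+,+)$. In each of them the tangents of the half fold angles of all creases are fixed real multiples of one parameter $t$; the full motion is obtained by letting $t$ range over $[-\infty,\infty]$, where a crease with multiplier $\lambda\neq0$ has fold angle $2\arctan(\lambda t)$, equal to $\pm\pi$ at $t=\pm\infty$ up to the sign of $\lambda$. *)

(* Defs.v *)
From HB Require Import structures.
From mathcomp Require Import all_boot all_order all_algebra.
From mathcomp Require Import all_classical all_reals all_analysis.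
Set Implicit Arguments.
Unset Strict Implicit.
Unset Printing Implicit Defensive.
Import Order.TTheory GRing.Theory Num.Theory.
Local Open Scope classical_set_scope.
Local Open Scope ring_scope.

(* Indices mod 4 are elements of 'I_4, whose ring structure is Z/4, so that
   i + 1 and i - 1 wrap around. *)

Section Geometry.
Variable R : realType.

Definition row2 (x y : R) : 'rV[R]_2 := \row_(j < 2) [:: x; y]`_j.
Definition row3 (x y z : R) : 'rV[R]_3 := \row_(j < 3) [:: x; y; z]`_j.

Definition fst2 (v : 'rV[R]_2) : R := v 0 0.
Definition snd2 (v : 'rV[R]_2) : R := v 0 1.

(* Euclidean length; the library norm on matrices is the sup norm. *)
Definition len2 (v : 'rV[R]_2) : R := Num.sqrt (fst2 v ^+ 2 + snd2 v ^+ 2).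

Definition rot2 (phi : R) (v : 'rV[R]_2) : 'rV[R]_2 :=
  row2 (cos phi * fst2 v - sin phi * snd2 v) (sin phi * fst2 v + cos phi * snd2 v).

Definition det2 (u v : 'rV[R]_2) : R := fst2 u * snd2 v - snd2 u * fst2 v.

Definition cross3 (u v : 'rV[R]_3) : 'rV[R]_3 :=
  row3 (u 0 1 * v 0 2%:R - u 0 2%:R * v 0 1)
       (u 0 2%:R * v 0 0 - u 0 0 * v 0 2%:R)
       (u 0 0 * v 0 1 - u 0 1 * v 0 0).

Definition lift3 (v : 'rV[R]_2) : 'rV[R]_3 := row3 (fst2 v) (snd2 v) 0.

Definition is_rotation (A : 'M[R]_3) : Prop := A *m A^T = 1%:M /\ \det A = 1.

(* Every isometric embedding of a planar face into space is the restriction of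
   a unique orientation-preserving isometry x |-> x *m A + v. *)
Definition placement : Type := ('M[R]_3 * 'rV[R]_3)%type.
Definition place (g : placement) (x : 'rV[R]_2) : 'rV[R]_3 :=
  lift3 x *m g.1 + g.2.
Definition place_dir (g : placement) (d : 'rV[R]_2) : 'rV[R]_3 :=
  lift3 d *m g.1.
Definition normal (g : placement) : 'rV[R]_3 := row3 0 0 1 *m g.1.

End Geometry.

Section Vertex.
Variable R : realType.
Implicit Types alpha beta x y : R.

Definition p x y : R :=
  (1 - tan (x / 2) * tan (y / 2)) / (1 + tan (x / 2) * tan (y / 2)).
Definition q x y : R :=
  (- tan (x / 2) + tan (y / 2)) / (tan (x / 2) + tan (y / 2)).

Definition sector alpha beta (i : 'I_4) : R :=
  [:: pi - alpha; pi - beta; alpha; beta]`_i.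

Definition is_vertex alpha beta (e : 'I_4 -> 'rV[R]_2) : Prop :=
  forall i, len2 (e i) = 1 /\ e (i + 1) = rot2 (sector alpha beta i) (e i).

Definition V_mode_a alpha beta (rho : 'I_4 -> R) : Prop :=
  exists tau : R, forall i : 'I_4,
    tan (rho i / 2) = [:: 1; p alpha beta; 1; - p alpha beta]`_i * tau.

Definition V_mode_b alpha beta (rho : 'I_4 -> R) : Prop :=
  exists tau : R, forall i : 'I_4,
    tan (rho i / 2) = [:: q alpha beta; 1; - q alpha beta; 1]`_i * tau.

End Vertex.

(* Side i is s_i; Tail i and Head i are the rays of direction e_i emanating
   from c_(i-1) and from c_i. *)
Inductive crease := Side of 'I_4 | Tail of 'I_4 | Head of 'I_4.

(* Strip i is bounded by s_i and the two rays of direction e_i; Wedge i lies at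
   c_i between the rays of directions e_i and e_(i+1). *)
Inductive face := Inner | Strip of 'I_4 | Wedge of 'I_4.

(* The faces to the left and to the right of a crease, where s_i is traversed
   from c_(i-1) to c_i and the rays are traversed outwards. *)
Definition left_face (k : crease) : face :=
  match k with Side _ => Inner | Tail i => Strip i | Head i => Wedge i end.
Definition right_face (k : crease) : face :=
  match k with Side i => Strip i | Tail i => Wedge (i - 1) | Head i => Strip i end.

Inductive vertex_mode := Plus | Minus.
Inductive DL_mode := aI | aII | bI | bII.

Definition mode_at (m : DL_mode) (i : 'I_4) : vertex_mode :=
  nth Plus (match m with
            | aI => [:: Minus; Plus; Plus; Minus]
            | aII => [:: Plus; Minus; Minus; Plus]
            | bI => [:: Plus; Plus; Minus; Minus]
            | bII => [:: Minus; Minus; Plus; Plus]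
            end) i.

Section DoubleLine.
Variable R : realType.

(* The directions e_i, the vertices c_i of P, and the center and radius of the
   disk of paper. *)
Record pattern := Pattern {
  edir : 'I_4 -> 'rV[R]_2;
  corner : 'I_4 -> 'rV[R]_2;
  center : 'rV[R]_2;
  radius : R
}.

Definition side_dir (theta : R) (D : pattern) (i : 'I_4) : 'rV[R]_2 :=
  rot2 (pi - theta) (edir D i).

Definition convex_ccw (c : 'I_4 -> 'rV[R]_2) : Prop :=
  forall i j : 'I_4, j != i -> j != i - 1 ->
    0 < det2 (c i - c (i - 1)) (c j - c (i - 1)).

Definition is_DL (alpha beta theta : R) (D : pattern) : Prop :=
  [/\ is_vertex alpha beta (edir D),
      convex_ccw (corner D),
      forall i, exists2 l : R, 0 < l &
        corner D i - corner D (i - 1) = l *: side_dir theta D i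
    & forall i, len2 (corner D i - center D) < radius D].

Definition crease_pts (D : pattern) (k : crease) : set 'rV[R]_2 :=
  match k with
  | Side i => [set corner D (i - 1) + s *: (corner D i - corner D (i - 1))
                | s in [set s : R | 0 <= s <= 1]]
  | Tail i => [set x | (exists2 s : R, 0 <= s & x = corner D (i - 1) + s *: edir D i)
                       /\ len2 (x - center D) <= radius D]
  | Head i => [set x | (exists2 s : R, 0 <= s & x = corner D i + s *: edir D i)
                       /\ len2 (x - center D) <= radius D]
  end.

Definition crease_dir (theta : R) (D : pattern) (k : crease) : 'rV[R]_2 :=
  match k with
  | Side i => side_dir theta D i
  | Tail i => edir D i
  | Head i => edir D i
  end.

(* The fold angle is the angle from the normal of the right face to the normal
   of the left face, measured about the folded crease. Reversing a crease swaps
   its two faces and so does not change the angle. *)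
Definition rigid_folded (theta : R) (D : pattern) (rho : crease -> R) : Prop :=
  exists g : face -> placement R,
    (forall F, is_rotation (g F).1) /\
    forall k, let l := g (left_face k) in let r := g (right_face k) in
      [/\ forall x, crease_pts D k x -> place l x = place r x,
          normal l = cos (rho k) *: normal r
            + sin (rho k) *: cross3 (place_dir r (crease_dir theta D k)) (normal r)
        & - pi <= rho k <= pi].

(* The creases at c_i in counterclockwise order: s_i, the rays of directions
   e_i and e_(i+1), s_(i+1). *)
Definition corner_crease (i : 'I_4) (j : 'I_4) : crease :=
  nth (Side i) [:: Side i; Head i; Tail (i + 1); Side (i + 1)] j.

Definition mode_vector (theta a : R) (s : vertex_mode) (j : 'I_4) : R :=
  match s with
  | Plus => [:: 1; - p theta a; 1; p theta a]`_j
  | Minus => [:: - q theta a; 1; q theta a; 1]`_j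
  end.

(* Meant for states with all fold angles in (-pi, pi), where the tangents are
   finite. *)
Definition corner_folds_in (alpha beta theta : R) (i : 'I_4) (s : vertex_mode)
    (rho : crease -> R) : Prop :=
  exists tau : R, forall j : 'I_4,
    tan (rho (corner_crease i j) / 2) =
      mode_vector theta (sector alpha beta i) s j * tau.

Definition fold_state (lam : crease -> R) (t : \bar R) (k : crease) : R :=
  match t with
  | r%:E => 2 * atan (lam k * r)
  | +oo%E => Num.sg (lam k) * pi
  | -oo%E => - (Num.sg (lam k) * pi)
  end.

Definition is_mode_motion (alpha beta theta : R) (D : pattern) (m : DL_mode)
    (lam : crease -> R) : Prop :=
  (exists k, lam k != 0) /\
  forall t : R, rigid_folded theta D (fold_state lam t%:E) /\
    forall i, corner_folds_in alpha beta theta i (mode_at m i) (fold_state lam t%:E).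

(* All states along the folding mode, the limit states t = -oo and t = +oo
   included. The multipliers lam are determined by m up to a common factor. *)
Definition full_motion (alpha beta theta : R) (D : pattern) (m : DL_mode) :
    set (crease -> R) :=
  [set rho | exists2 lam, is_mode_motion alpha beta theta D m lam &
             exists t : \bar R, rho = fold_state lam t].

Definition fold_sum (rho : crease -> R) (i : 'I_4) : R := rho (Tail i) + rho (Head i).

(* fold_sum rho i is S_i; the tangent of S_i / 2 is finite when the cosine does not vanish. *)
Definition corresponds (V_mode : ('I_4 -> R) -> Prop) (M : set (crease -> R)) : Prop :=
  forall rho, M rho -> (forall i, cos (fold_sum rho i / 2) != 0) -> V_mode (fold_sum rho).

Definition S_values (alpha beta theta : R) (D : pattern) (m : DL_mode) (i : 'I_4) :
    set R :=
  [set fold_sum rho i | rho in full_motion alpha beta theta D m].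

Definition spans_full (alpha beta theta : R) (D : pattern) (m : DL_mode) : Prop :=
  forall i, S_values alpha beta theta D m i = [set s | - (2 * pi) <= s <= 2 * pi].

Definition spans_less_than_pi (alpha beta theta : R) (D : pattern) (m : DL_mode) : Prop :=
  forall i, exists2 M : R, 0 <= M < pi &
    S_values alpha beta theta D m i = [set s | - M <= s <= M].

End DoubleLine.

(* Main.v *)
(* Up to a cyclic shift of the corners, each of the four modes folds the corners
   in modes (+, +, -, -). Writing k for the first of them and
   x = p(theta, alpha_k), y = p(theta, alpha_(k+1)), the identities
   alpha_(k+2) = pi - alpha_k and q(theta, pi - a) = p(theta, a) turn the corner
   relations into a linear system whose solutions are the multiples of
     sides 1, x, xy, -y;  tails y, 1, x, -xy;  heads -x, -xy, -y, 1.
   Such multipliers fold rigidly because the corner relation says that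
   (1 + h e)(1 + t e') = (1 + s d)(1 - s' d') for the quaternions with axes along
   the creases, so that the rotations around a corner compose to the identity.
   In each parallel pair the product of the multipliers is -xy, and the tangent
   addition formula gives tangents of S_i / 2 proportional to
   y - x, 1 - xy, x - y, 1 - xy, where (y - x) / (1 - xy) does not depend on theta.
   If xy < 0, both creases of a pair turn the same way and S_i sweeps
   [-2 pi, 2 pi]; if xy > 0 they turn in opposite ways, and by the arithmetic-
   geometric mean inequality |S_i| is maximal at t = 1 / sqrt(xy). *)
Require Import Defs.
From mathcomp Require Import all_boot all_order all_algebra.
From mathcomp Require Import all_classical all_reals all_analysis.
From mathcomp Require Import ring lra.
Import Order.TTheory GRing.Theory Num.Theory.
Import numFieldNormedType.Exports.
Local Open Scope ring_scope.

(** * Rotations *)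

(* Matrices act on row vectors on the right, hence the transpose of the usual
   matrix of v |-> q v q^-1 and the reversed order of factors in quat_mxM. *)
Definition quat_mx {R : realType} (w x y z : R) : 'M[R]_3 :=
  (w ^+ 2 + x ^+ 2 + y ^+ 2 + z ^+ 2)^-1 *:
  \matrix_(i < 3, j < 3) nth 0 (nth [::]
    [:: [:: w ^+ 2 + x ^+ 2 - y ^+ 2 - z ^+ 2; 2 * (x * y + w * z); 2 * (x * z - w * y)];
        [:: 2 * (x * y - w * z); w ^+ 2 - x ^+ 2 + y ^+ 2 - z ^+ 2; 2 * (y * z + w * x)];
        [:: 2 * (x * z + w * y); 2 * (y * z - w * x); w ^+ 2 - x ^+ 2 - y ^+ 2 + z ^+ 2]]
    i) j.

Lemma quat_mxM {R : realType} (w x y z w' x' y' z' : R) :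
  w ^+ 2 + x ^+ 2 + y ^+ 2 + z ^+ 2 != 0 ->
  w' ^+ 2 + x' ^+ 2 + y' ^+ 2 + z' ^+ 2 != 0 ->
  quat_mx w x y z *m quat_mx w' x' y' z' =
  quat_mx (w' * w - x' * x - y' * y - z' * z)
          (w' * x + x' * w + y' * z - z' * y)
          (w' * y - x' * z + y' * w + z' * x)
          (w' * z + x' * y - y' * x + z' * w).
Proof.
move=> h h'; rewrite /quat_mx -scalemxAl -scalemxAr scalerA -invfM.
(* Euler's four-square identity: the norm of quaternions is multiplicative. *)
have -> : (w' * w - x' * x - y' * y - z' * z) ^+ 2 + (w' * x + x' * w + y' * z - z' * y) ^+ 2
  + (w' * y - x' * z + y' * w + z' * x) ^+ 2 + (w' * z + x' * y - y' * x + z' * w) ^+ 2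
  = (w ^+ 2 + x ^+ 2 + y ^+ 2 + z ^+ 2) * (w' ^+ 2 + x' ^+ 2 + y' ^+ 2 + z' ^+ 2) by ring.
rewrite [X in X^-1]mulrC; congr (_ *: _).
apply/matrixP => -[[|[|[|//]]] ?] -[[|[|[|//]]] ?];
  by rewrite !mxE !big_ord_recl big_ord0 !mxE /=; ring.
Qed.

(** Compatibility with cross products carries the formula for the folded normal through the
    placement of the right face in [hinged_normal]. *)
Definition proper {R : realType} (A : 'M[R]_3) : Prop :=
  is_rotation A /\
  forall u v : 'rV[R]_3, cross3 (u *m A) (v *m A) = cross3 u v *m A.

Lemma properM {R : realType} (A B : 'M[R]_3) : proper A -> proper B -> proper (A *m B).
Proof.
move=> [[AA dA] cA] [[BB dB] cB]; split; last first.
  by move=> u v; rewrite !mulmxA cB cA.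
split; last by rewrite det_mulmx dA dB mulr1.
by rewrite trmx_mul mulmxA -(mulmxA A) BB mulmx1 AA.
Qed.

Lemma det3E {R : realType} (A : 'M[R]_3) (a : nat -> nat -> R) :
  (forall i j : 'I_3, A i j = a i j) ->
  \det A = a 0%N 0%N * (a 1%N 1%N * a 2%N 2%N - a 1%N 2%N * a 2%N 1%N)
         - a 0%N 1%N * (a 1%N 0%N * a 2%N 2%N - a 1%N 2%N * a 2%N 0%N)
         + a 0%N 2%N * (a 1%N 0%N * a 2%N 1%N - a 1%N 1%N * a 2%N 0%N).
Proof.
move=> E; rewrite (expand_det_row _ 0) !big_ord_recl big_ord0 /cofactor.
rewrite !(expand_det_row _ 0) !big_ord_recl !big_ord0 /cofactor !det_mx11 !mxE !E /=.
by rewrite !addn0 !add0n /bump /= ; ring.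
Qed.

(** The four entries are those that [quat_mxM] yields for a quaternion and its conjugate; the
    product is the norm, a real number. *)
Lemma quat_mxV {R : realType} (w x y z : R) :
  w ^+ 2 + x ^+ 2 + y ^+ 2 + z ^+ 2 != 0 ->
  quat_mx (w * w - - x * x - - y * y - - z * z) (w * x + - x * w + - y * z - - z * y)
    (w * y - - x * z + - y * w + - z * x) (w * z + - x * y - - y * x + - z * w) = 1%:M.
Proof.
set N := (X in X != 0) => h.
have -> : w * w - - x * x - - y * y - - z * z = N by rewrite /N; ring.
have -> : w * x + - x * w + - y * z - - z * y = 0 by ring.
have -> : w * y - - x * z + - y * w + - z * x = 0 by ring.
have -> : w * z + - x * y - - y * x + - z * w = 0 by ring.
apply/matrixP => -[[|[|[|//]]] ?] -[[|[|[|//]]] ?];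
  by rewrite !mxE /=; field; rewrite h.
Qed.

Lemma quat_mx_proper {R : realType} (w x y z : R) :
  w ^+ 2 + x ^+ 2 + y ^+ 2 + z ^+ 2 != 0 -> proper (quat_mx w x y z).
Proof.
move=> h; split; last first.
  move=> u v; rewrite /quat_mx -!scalemxAr.
  (* Naming coordinates by functions on [nat] gives [field] a single atom for ordinals that differ
     only in the proof of their bound. *)
  have [a ua] : exists a : nat -> R, forall i, u 0 i = a i.
    by exists (fun i => u 0 (inord i)) => i; rewrite inord_val.
  have [b vb] : exists b : nat -> R, forall i, v 0 i = b i.
    by exists (fun i => v 0 (inord i)) => i; rewrite inord_val.
  apply/matrixP => -[[|//] ?] -[[|[|[|//]]] ?];
    rewrite !mxE /= ?mxE ?big_ord_recl ?big_ord0 ?mxE /=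
      ?big_ord_recl ?big_ord0 ?mxE /= !ua !vb /bump /=
      -![(1 %% 3)%N]/1%N -![((1 + 1) %% 3)%N]/2%N; by field.
split.
  have -> : (quat_mx w x y z)^T = quat_mx w (- x) (- y) (- z).
    rewrite /quat_mx linearZ /= !sqrrN; congr (_ *: _).
    by apply/matrixP => -[[|[|[|//]]] ?] -[[|[|[|//]]] ?]; rewrite !mxE /=; ring.
  by rewrite quat_mxM ?sqrrN // quat_mxV.
rewrite /quat_mx detZ (@det3E _ _ (fun i j => nth 0 (nth [::]
    [:: [:: w ^+ 2 + x ^+ 2 - y ^+ 2 - z ^+ 2; 2 * (x * y + w * z); 2 * (x * z - w * y)];
        [:: 2 * (x * y - w * z); w ^+ 2 - x ^+ 2 + y ^+ 2 - z ^+ 2; 2 * (y * z + w * x)];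
        [:: 2 * (x * z + w * y); 2 * (y * z - w * x); w ^+ 2 - x ^+ 2 - y ^+ 2 + z ^+ 2]]
    i) j)) => [|i j]; last by rewrite mxE.
by rewrite /=; field.
Qed.

(** The quaternion 1 + s d: for a unit vector [d] it rotates about [d] by the angle whose half has
    tangent [s]. *)
Definition rot_mx {R : realType} (s : R) (d : 'rV[R]_2) : 'M[R]_3 :=
  quat_mx 1 (s * fst2 d) (s * snd2 d) 0.

Lemma one_add_sqr2_neq0 {R : realType} (x y : R) : 1 + x ^+ 2 + y ^+ 2 != 0.
Proof. by apply: lt0r_neq0; nra. Qed.

Lemma quat_planar_neq0 {R : realType} (x y : R) :
  1 ^+ 2 + x ^+ 2 + y ^+ 2 + 0 ^+ 2 != 0.
Proof. by apply: lt0r_neq0; nra. Qed.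

Lemma rot_mx_proper {R : realType} (s : R) (d : 'rV[R]_2) : proper (rot_mx s d).
Proof. exact: quat_mx_proper (quat_planar_neq0 _ _). Qed.

Lemma rot_mxV {R : realType} (s : R) (d : 'rV[R]_2) :
  rot_mx s d *m rot_mx (- s) d = 1%:M.
Proof.
rewrite quat_mxM ?quat_planar_neq0 // -(@quat_mxV _ 1 (s * fst2 d) (s * snd2 d) 0).
  by rewrite oppr0 !mulNr.
exact: quat_planar_neq0.
Qed.

Lemma rot_mx_axis {R : realType} (s : R) (d : 'rV[R]_2) :
  lift3 d *m rot_mx s d = lift3 d.
Proof.
rewrite -scalemxAr.
apply/matrixP => -[[|//] ?] -[[|[|[|//]]] ?];
  rewrite !mxE ?big_ord_recl ?big_ord0 ?mxE /= ?mxE /=;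
  field; exact: one_add_sqr2_neq0.
Qed.

Lemma cos_half {R : realType} (x : R) : cos (x / 2) != 0 ->
  cos x = (1 - tan (x / 2) ^+ 2) / (1 + tan (x / 2) ^+ 2).
Proof.
move=> h; have e := cos2Dsin2 (x / 2).
have -> : cos x = cos (x / 2 + x / 2) by rewrite -splitr.
move: h e; rewrite cosD /tan; set c := cos _; set s := sin _ => h e.
have -> : 1 - (s / c) ^+ 2 = (c * c - s * s) / c ^+ 2 by field.
have -> : 1 + (s / c) ^+ 2 = (c ^+ 2)^-1 by rewrite -[RHS]div1r -[X in _ = X / _]e; field.
by field.
Qed.

Lemma sin_half {R : realType} (x : R) : cos (x / 2) != 0 ->
  sin x = 2 * tan (x / 2) / (1 + tan (x / 2) ^+ 2).
Proof.
move=> h; have e := cos2Dsin2 (x / 2).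
have -> : sin x = sin (x / 2 + x / 2) by rewrite -splitr.
move: h e; rewrite sinD /tan; set c := cos _; set s := sin _ => h e.
have -> : 1 + (s / c) ^+ 2 = (c ^+ 2)^-1 by rewrite -[RHS]div1r -[X in _ = X / _]e; field.
by field.
Qed.

Lemma cos_atan_gt0 {R : realType} (x : R) : 0 < cos (atan x).
Proof. by apply: cos_gt0_pihalf; rewrite atan_gtNpi2 atan_ltpi2. Qed.

Lemma atan_halfE {R : realType} (x : R) : 2 * atan x / 2 = atan x.
Proof. by field. Qed.

Lemma rot_mx_normal {R : realType} (s : R) (d : 'rV[R]_2) : len2 d = 1 ->
  row3 0 0 1 *m rot_mx s d = cos (2 * atan s) *: row3 0 0 1
    + sin (2 * atan s) *: cross3 (lift3 d) (row3 0 0 1).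
Proof.
move=> /(congr1 (fun x => x ^+ 2)); rewrite sqr_sqrtr ?addr_ge0 ?sqr_ge0 // expr1n => h.
have c : cos (2 * atan s / 2) != 0 by rewrite atan_halfE gt_eqF ?cos_atan_gt0.
rewrite (cos_half _ c) (sin_half _ c) atan_halfE atanK -scalemxAr.
have -> : 1 ^+ 2 + (s * fst2 d) ^+ 2 + (s * snd2 d) ^+ 2 + 0 ^+ 2 = 1 + s ^+ 2.
  by rewrite -[in RHS](mulr1 (s ^+ 2)) -[in X in _ = _ + _ * X]h; ring.
have hs := one_add_sqr2_neq0 s 0; rewrite expr0n addr0 in hs.
have E : (s * snd2 d) ^+ 2 = s ^+ 2 - (s * fst2 d) ^+ 2.
  by rewrite !exprMn -[in X in _ = X - _](mulr1 (s ^+ 2)) -[in X in _ = _ * X - _]h; ring.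
apply/matrixP => -[[|//] ?] -[[|[|[|//]]] ?];
  rewrite !mxE /= ?mxE ?big_ord_recl ?big_ord0 ?mxE /= ?mxE /= ?E; field; exact: hs.
Qed.

(** * Rigid folding *)

Lemma half_range {R : realType} (x : R) : 0 < x < pi -> 0 < x / 2 < pi / 2.
Proof. by move=> h; lra. Qed.

Lemma cos_half_neq0 {R : realType} (x : R) : 0 < x < pi -> cos (x / 2) != 0.
Proof.
move=> /half_range h; have p0 := pi_gt0 R.
by rewrite gt_eqF // cos_gt0_pihalf //; lra.
Qed.

Lemma tan_half_gt0 {R : realType} (x : R) : 0 < x < pi -> 0 < tan (x / 2).
Proof.
move=> /half_range h; have p0 := pi_gt0 R.
by rewrite divr_gt0 ?sin_gt0_pihalf ?cos_gt0_pihalf //; lra.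
Qed.

Lemma tan_half_pi_sub {R : realType} (a : R) : tan ((pi - a) / 2) = (tan (a / 2))^-1.
Proof.
have -> : (pi - a) / 2 = - (a / 2 - pi / 2) by ring.
by rewrite /tan sinN cosN cosBpihalf sinBpihalf opprK invf_div.
Qed.

(* The mode vector relation at a corner, with the parameter tau eliminated. *)
Definition corner_rel {R : realType} (theta a : R) (m : vertex_mode)
    (s h t s' : R) : Prop :=
  match m with
  | Plus => [/\ h = - p theta a * s, t = s & s' = p theta a * s]
  | Minus => [/\ s = - q theta a * s', h = s' & t = q theta a * s']
  end.

(** The left side crosses the two rays at the corner, the right side the two sides of the
    quadrilateral. The quaternions agree exactly, not only up to a scalar, so their components are
    compared one by one, as rational functions of tan (theta / 2) and tan (a / 2). *)
Lemma corner_closure {R : realType} (theta a : R) (m : vertex_mode)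
    (s h t s' : R) (e : 'rV[R]_2) :
  0 < theta < pi -> 0 < a < pi -> corner_rel theta a m s h t s' ->
  rot_mx t (rot2 a e) *m rot_mx h e =
  rot_mx (- s') (rot2 (pi - theta) (rot2 a e)) *m rot_mx s (rot2 (pi - theta) e).
Proof.
move=> ht ha rel.
rewrite /rot_mx !quat_mxM ?quat_planar_neq0 // /rot2 /fst2 /snd2 !mxE /=.
rewrite [cos (pi - _)]cosB [sin (pi - _)]sinB cospi sinpi.
rewrite !(cos_half theta) ?(sin_half theta) ?(cos_half a) ?(sin_half a) ?cos_half_neq0 //.
move: rel; rewrite /corner_rel /p /q.
have := tan_half_gt0 _ ht; have := tan_half_gt0 _ ha.
move: (tan (a / 2)) (tan (theta / 2)) (e 0 0) (e 0 1) => v u x y v0 u0.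
have hu : 1 + u ^+ 2 != 0 by apply: lt0r_neq0; nra.
have hv : 1 + v ^+ 2 != 0 by apply: lt0r_neq0; nra.
have hp : 1 + u * v != 0 by apply: lt0r_neq0; nra.
have hq : u + v != 0 by apply: lt0r_neq0; nra.
case: m => -[-> -> ->]; congr quat_mx;
  field; by rewrite hu hv ?hp ?hq.
Qed.

(** The translation part keeps [c] at its place in the plane of the inner face, so faces pivoting at
    the same corner agree there. *)
Definition pivot {R : realType} (A : 'M[R]_3) (c : 'rV[R]_2) : placement R :=
  (A, lift3 c - lift3 c *m A).

Lemma place_pivot {R : realType} (A : 'M[R]_3) (c : 'rV[R]_2) :
  place (pivot A c) c = lift3 c.
Proof. by rewrite /place /= addrC subrK. Qed.

Lemma lift3D {R : realType} (c d : 'rV[R]_2) (k : R) :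
  lift3 (c + k *: d) = lift3 c + k *: lift3 d.
Proof.
by apply/matrixP => -[[|//] ?] -[[|[|[|//]]] ?]; rewrite !mxE /= ?mxE /fst2 /snd2 /= ?mxE //; ring.
Qed.

Lemma placeD {R : realType} (g : placement R) (c d : 'rV[R]_2) (k : R) :
  place g (c + k *: d) = place g c + k *: place_dir g d.
Proof. by rewrite /place /place_dir lift3D mulmxDl -scalemxAl addrAC. Qed.

Lemma place_pivot_axis {R : realType} (s k : R) (d c : 'rV[R]_2) :
  place (pivot (rot_mx s d) c) (c + k *: d) = lift3 (c + k *: d).
Proof. by rewrite placeD place_pivot /place_dir rot_mx_axis lift3D. Qed.

(* The face l is obtained from the face r by folding about the line through c of
   direction d, by the angle whose half has tangent s. *)
Definition hinged {R : realType} (s : R) (c d : 'rV[R]_2) (l r : placement R) : Prop :=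
  [/\ place l c = place r c, l.1 = rot_mx s d *m r.1 & proper r.1].

Lemma hinged_place {R : realType} (s k : R) (c d : 'rV[R]_2) (l r : placement R) :
  hinged s c d l r -> place l (c + k *: d) = place r (c + k *: d).
Proof.
move=> [e E _]; rewrite !placeD e; congr (_ + _ *: _).
by rewrite /place_dir E mulmxA rot_mx_axis.
Qed.

Lemma hinged_normal {R : realType} (s : R) (c d : 'rV[R]_2) (l r : placement R) :
  len2 d = 1 -> hinged s c d l r ->
  normal l = cos (2 * atan s) *: normal r
    + sin (2 * atan s) *: cross3 (place_dir r d) (normal r).
Proof.
move=> d1 [_ E [_ pr]]; rewrite /normal E mulmxA rot_mx_normal // mulmxDl.
by rewrite -!scalemxAl /place_dir pr.
Qed.

Lemma len2_rot2 {R : realType} (phi : R) (v : 'rV[R]_2) : len2 (rot2 phi v) = len2 v.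
Proof.
rewrite /len2 /rot2 /fst2 /snd2 !mxE /=; congr Num.sqrt.
have := cos2Dsin2 phi; move: (cos phi) (sin phi) (v 0 0) (v 0 1) => c s x y e.
transitivity ((c ^+ 2 + s ^+ 2) * (x ^+ 2 + y ^+ 2)); first by ring.
by rewrite e mul1r.
Qed.

Lemma sector_range {R : realType} (alpha beta : R) (i : 'I_4) :
  0 < alpha < pi -> 0 < beta < pi -> 0 < sector alpha beta i < pi.
Proof. by case: i => -[|[|[|[|//]]]] ? ha hb; rewrite /sector /=; lra. Qed.

Definition crease_rel {R : realType} (alpha beta theta : R) (m : 'I_4 -> vertex_mode)
    (lam : crease -> R) (i : 'I_4) : Prop :=
  corner_rel theta (sector alpha beta i) (m i)
    (lam (Side i)) (lam (Head i)) (lam (Tail (i + 1))) (lam (Side (i + 1))).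

Lemma corner_relZ {R : realType} (theta a r : R) m (s h t s' : R) :
  corner_rel theta a m s h t s' ->
  corner_rel theta a m (s * r) (h * r) (t * r) (s' * r).
Proof. by case: m => -[-> -> ->]; split=> //; ring. Qed.

(** The inner face stays fixed, each strip turns about its side, and each wedge turns about a head
    ray relative to its strip. The sides and heads are then hinges by construction; the tails are
    hinges because the corners close up. *)
Lemma rigid_folded_of_corners {R : realType} (alpha beta theta : R)
  (D : pattern R) (m : 'I_4 -> vertex_mode) (lam : crease -> R) (r : R) :
  0 < alpha < pi -> 0 < beta < pi -> 0 < theta < pi ->
  is_DL alpha beta theta D ->
  (forall i, crease_rel alpha beta theta m lam i) ->
  rigid_folded theta D (fold_state lam r%:E).
Proof.
move=> ha hb ht [hV _ hS _] rel.
pose strip i := rot_mx (- (lam (Side i) * r)) (side_dir theta D i).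
pose wedge i := rot_mx (lam (Head i) * r) (edir D i) *m strip i.
pose g F := match F with
  | Inner => (1%:M, 0)
  | Strip i => pivot (strip i) (corner D i)
  | Wedge i => pivot (wedge i) (corner D i) end.
have pstrip i : proper (strip i) by exact: rot_mx_proper.
have pwedge i : proper (wedge i) by apply: properM => //; exact: rot_mx_proper.
have p1 : proper (1%:M : 'M[R]_3).
  by split=> [|u v]; rewrite ?mulmx1 //; split; rewrite ?trmx1 ?mulmx1 ?det1.
have pg F : proper (g F).1 by case: F.
have hE i : len2 (edir D i) = 1 by case: (hV i).
have hSd i : len2 (side_dir theta D i) = 1 by rewrite len2_rot2.
have place1 x : place (g Inner) x = lift3 x by rewrite /place /= mulmx1 addr0.
have prev i : exists2 l : R, 0 < l & corner D (i - 1) = corner D i + (- l) *: side_dir theta D i.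
  by case: (hS i) => l l0 e; exists l => //; rewrite scaleNr -e opprB [RHS]addrC subrK.
pose base k := match k with
  | Side i => corner D i | Tail i => corner D (i - 1) | Head i => corner D i end.
have hg k : hinged (lam k * r) (base k) (crease_dir theta D k)
    (g (left_face k)) (g (right_face k)).
  case: k => i; split; rewrite ?place1 ?place_pivot //=.
  - by rewrite rot_mxV.
  (* The strip pivots at c_i, but its axis s_i also passes through c_(i-1), which therefore stays
     fixed too. *)
  - by have [l _ ->] := prev i; rewrite place_pivot_axis.
  (* After closure at c_(i-1), the turn about s_(i-1) cancels against the placement of strip i -
     1. *)
  - rewrite -[i in LHS](subrK 1) /wedge mulmxA.
    have [_ e'] := hV (i - 1).
    have := corner_closure _ _ _ _ _ _ _ (edir D (i - 1)) ht (sector_range _ _ (i - 1) ha hb)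
       (corner_relZ _ _ r _ _ _ _ _ (rel (i - 1))).
    rewrite -e' !subrK => ->.
    by rewrite -mulmxA rot_mxV mulmx1.
exists g; split=> [F|k /=]; first by case: (pg F).
have hk := hg k; split.
- move=> x hx.
  suff [s ->] : exists s, x = base k + s *: crease_dir theta D k.
    exact: hinged_place hk.
  case: k {hk} hx => i /=.
  (* The side is parametrized from c_(i-1) but the hinge is based at c_i, hence s - 1. *)
  + case=> s _ <-; have [l _ e] := prev i; exists ((s - 1) * l); rewrite e.
    rewrite opprD addrA subrr add0r -scaleNr opprK scalerA -addrA -scalerDl.
    by congr (_ + _ *: _); ring.
  + by case=> -[s _ ->] _; exists s.
  + by case=> -[s _ ->] _; exists s.
- by apply: hinged_normal hk; case: k => i /=.
- have := atan_gtNpi2 (lam k * r); have := atan_ltpi2 (lam k * r); lra.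
Qed.

(** * Multipliers of the modes *)

(* Each mode assigns (+, +, -, -) to the corners start m, start m + 1, ... *)
Definition start (m : DL_mode) : 'I_4 :=
  match m with bI => 0 | aI => 1 | bII => 2%:R | aII => 3%:R end.

Lemma I4_ind (P : 'I_4 -> Prop) : P 0 -> P 1 -> P (1 + 1) -> P (1 + 1 + 1) -> forall i, P i.
Proof.
move=> P0 P1 P2 P3 [[|[|[|[|//]]]] h].
- by have -> : Ordinal h = 0 by apply: val_inj.
- by have -> : Ordinal h = 1 by apply: val_inj.
- by have -> : Ordinal h = 1 + 1 by apply: val_inj.
- by have -> : Ordinal h = 1 + 1 + 1 by apply: val_inj.
Qed.

Lemma I4_shift_ind (k : 'I_4) (P : 'I_4 -> Prop) :
  P k -> P (k + 1) -> P (k + 1 + 1) -> P (k + 1 + 1 + 1) -> forall i, P i.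
Proof.
move=> P0 P1 P2 P3 i; have -> : i = k + (i - k) by rewrite addrC subrK.
by elim/I4_ind: (i - k); rewrite ?addr0 ?addrA.
Qed.

Lemma I4_four (k : 'I_4) : k + 1 + 1 + 1 + 1 = k.
Proof. by case: k => -[|[|[|[|//]]]] ?; apply: val_inj. Qed.

(** Kawasaki's condition for flat-foldability. *)
Lemma sector_opp {R : realType} (alpha beta : R) (k : 'I_4) :
  sector alpha beta (k + 1 + 1) = pi - sector alpha beta k.
Proof. by case: k => -[|[|[|[|//]]]] ?; rewrite /sector /=; ring. Qed.

(** The solution of the corner relations normalized to 1 on s_k; entry j of each list belongs to the
    index k + j. *)
Definition multiplier {R : realType} (k : 'I_4) (x y : R) (c : crease) : R :=
  match c with
  | Side i => [:: 1; x; x * y; - y]`_((i - k)%R)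
  | Tail i => [:: y; 1; x; - (x * y)]`_((i - k)%R)
  | Head i => [:: - x; - (x * y); - y; 1]`_((i - k)%R)
  end.

Lemma multiplierE {R : realType} (k : 'I_4) (x y : R) :
  let lam := multiplier k x y in
  [/\ [/\ lam (Side k) = 1, lam (Side (k + 1)) = x, lam (Side (k + 1 + 1)) = x * y
         & lam (Side (k + 1 + 1 + 1)) = - y],
      [/\ lam (Tail k) = y, lam (Tail (k + 1)) = 1, lam (Tail (k + 1 + 1)) = x
         & lam (Tail (k + 1 + 1 + 1)) = - (x * y)]
    & [/\ lam (Head k) = - x, lam (Head (k + 1)) = - (x * y), lam (Head (k + 1 + 1)) = - y
         & lam (Head (k + 1 + 1 + 1)) = 1]].
Proof.
have [d0 d1 d2 d3] : [/\ k - k = 0, k + 1 - k = 1, k + 1 + 1 - k = 2%:R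
    & k + 1 + 1 + 1 - k = 3%:R].
  by case: k => -[|[|[|[|//]]]] ?; split; apply: val_inj.
move=> lam; split; split; rewrite /lam /multiplier;
  by rewrite ?d0 ?d1 ?d2 ?d3.
Qed.

Lemma q_pi_sub {R : realType} (theta a : R) :
  0 < theta < pi -> 0 < a < pi -> q theta (pi - a) = p theta a.
Proof.
move=> ht ha.
have := tan_half_gt0 _ ht; have := tan_half_gt0 _ ha.
rewrite /q /p tan_half_pi_sub; move: (tan (a / 2)) (tan (theta / 2)) => v u v0 u0.
by field; rewrite !gt_eqF //; nra.
Qed.

Lemma mode_start {m : DL_mode} (k := start m) :
  [/\ mode_at m k = Plus, mode_at m (k + 1) = Plus, mode_at m (k + 1 + 1) = Minus
    & mode_at m (k + 1 + 1 + 1) = Minus].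
Proof. by case: m @k. Qed.

Lemma corner_folds_in_rel {R : realType} (alpha beta theta r : R) (i : 'I_4)
    (s : vertex_mode) (lam : crease -> R) :
  corner_folds_in alpha beta theta i s (fold_state lam r%:E) <->
  corner_rel theta (sector alpha beta i) s
    (lam (Side i) * r) (lam (Head i) * r) (lam (Tail (i + 1)) * r) (lam (Side (i + 1)) * r).
Proof.
rewrite /corner_folds_in /fold_state; split=> [[tau h]|h].
  have := h 0; have := h 1; have := h 2%:R; have := h 3%:R.
  rewrite !atan_halfE !atanK /corner_crease /=.
  by case: s {h} => /=; rewrite ?mul1r => -> -> -> ->.
(* The parameter is read off at an entry 1 of the mode vector. *)
exists (if s is Plus then lam (Side i) * r else lam (Head i) * r) => j.
rewrite atan_halfE atanK /corner_crease.
by case: s h => -[h1 h2 h3]; case: j => -[|[|[|[|//]]]] ? /=; rewrite ?mul1r ?h1 ?h2 ?h3.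
Qed.

Section Multipliers.
Variables (R : realType) (alpha beta theta : R) (m : DL_mode).
Hypotheses (ha : 0 < alpha < pi) (hb : 0 < beta < pi) (ht : 0 < theta < pi).
Let k := start m.
Let x := p theta (sector alpha beta k).
Let y := p theta (sector alpha beta (k + 1)).

Lemma corner_relE (lam : crease -> R) :
  (forall i, crease_rel alpha beta theta (mode_at m) lam i) <->
  [/\ [/\ lam (Head k) = - x * lam (Side k), lam (Tail (k + 1)) = lam (Side k)
         & lam (Side (k + 1)) = x * lam (Side k)],
      [/\ lam (Head (k + 1)) = - y * lam (Side (k + 1)),
          lam (Tail (k + 1 + 1)) = lam (Side (k + 1))
        & lam (Side (k + 1 + 1)) = y * lam (Side (k + 1))],
      [/\ lam (Side (k + 1 + 1)) = - x * lam (Side (k + 1 + 1 + 1)),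
          lam (Head (k + 1 + 1)) = lam (Side (k + 1 + 1 + 1))
        & lam (Tail (k + 1 + 1 + 1)) = x * lam (Side (k + 1 + 1 + 1))]
    & [/\ lam (Side (k + 1 + 1 + 1)) = - y * lam (Side k),
          lam (Head (k + 1 + 1 + 1)) = lam (Side k) & lam (Tail k) = y * lam (Side k)]].
Proof.
have [m0 m1 m2 m3] := @mode_start m.
have q2 : q theta (sector alpha beta (k + 1 + 1)) = x.
  by rewrite sector_opp q_pi_sub // sector_range.
have q3 : q theta (sector alpha beta (k + 1 + 1 + 1)) = y.
  by rewrite sector_opp q_pi_sub // sector_range.
have k4 := I4_four k.
split=> [h|[h0 h1 h2 h3]].
  have := h k; have := h (k + 1); have := h (k + 1 + 1); have := h (k + 1 + 1 + 1).
  by rewrite /crease_rel m0 m1 m2 m3 k4 /corner_rel q2 q3.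
elim/(@I4_shift_ind k);
  by rewrite /crease_rel ?m0 ?m1 ?m2 ?m3 ?k4 /corner_rel ?q2 ?q3.
Qed.

(** The cyclic system closes up because corners k + 1 and k + 2 give s_(k+2) the same multiplier: y
    x and (- x) (- y). *)
Lemma multiplier_rel i :
  crease_rel alpha beta theta (mode_at m) (multiplier k x y) i.
Proof.
move: i; apply/corner_relE.
have [[-> -> -> ->] [-> -> -> ->] [-> -> -> ->]] := multiplierE k x y.
by do !split; ring.
Qed.

Lemma multiplier_unique (lam : crease -> R) :
  (forall i, crease_rel alpha beta theta (mode_at m) lam i) ->
  forall c, lam c = lam (Side k) * multiplier k x y c.
Proof.
move=> /corner_relE [[h0 t1 s1] [h1 t2 s2] [s2' h2 t3] [s3 h3 t0]].
have [[S0 S1 S2 S3] [T0 T1 T2 T3] [H0 H1 H2 H3]] := multiplierE k x y.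
case; elim/(@I4_shift_ind k);
rewrite ?S0 ?S1 ?S2 ?S3 ?T0 ?T1 ?T2 ?T3 ?H0 ?H1 ?H2 ?H3
  ?h0 ?h1 ?h2 ?h3 ?t0 ?t1 ?t2 ?t3 ?s2 ?s3 ?s1; by ring.
Qed.

Lemma multiplierM i :
  multiplier k x y (Tail i) * multiplier k x y (Head i) = - (x * y).
Proof.
have [[S0 S1 S2 S3] [T0 T1 T2 T3] [H0 H1 H2 H3]] := multiplierE k x y.
by elim/(@I4_shift_ind k): i;
  rewrite ?T0 ?T1 ?T2 ?T3 ?H0 ?H1 ?H2 ?H3; ring.
Qed.

Lemma full_motionE (D : pattern R) (rho : crease -> R) :
  is_DL alpha beta theta D ->
  full_motion alpha beta theta D m rho <->
  exists t, rho = fold_state (multiplier k x y) t.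
Proof.
move=> hD; have [[S0 _ _ _] _ _] := multiplierE k x y; split; last first.
  move=> [t ->]; exists (multiplier k x y); last by exists t.
  split; first by exists (Side k); rewrite S0 oner_neq0.
  move=> r; split; first exact: (rigid_folded_of_corners _ _ _ _ _ _ _ ha hb ht hD multiplier_rel).
  move=> i; apply/corner_folds_in_rel; apply: corner_relZ; exact: multiplier_rel.
move=> [lam [[c lam_c] hlam] [t ->]].
have E := multiplier_unique lam.
have {}E c' : lam c' = lam (Side k) * multiplier k x y c'.
  (* At t = 1 the tangents of the half fold angles are the multipliers themselves. *)
  apply: E => i; have [_ /(_ i)] := hlam 1.
  by move=> /corner_folds_in_rel; rewrite !mulr1.
have l0 : lam (Side k) != 0 by apply: contraNneq lam_c => l0; rewrite E l0 mul0r.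
(* Rescaling the parameter absorbs the common factor; a negative factor swaps the two infinite
   states. *)
exists (match t with
  | r%:E => (lam (Side k) * r)%:E
  | +oo%E => if 0 < lam (Side k) then +oo%E else -oo%E
  | -oo%E => if 0 < lam (Side k) then -oo%E else +oo%E end).
apply/funext => c'; rewrite /fold_state; case: t => [r| |].
- by rewrite E; congr (2 * atan _); ring.
- rewrite E sgrM; case: ltP => [l|]; first by rewrite gtr0_sg ?mul1r.
  by rewrite le_eqVlt (negbTE l0) /= => l; rewrite ltr0_sg ?mulN1r ?mulNr.
- rewrite E sgrM; case: ltP => [l|]; first by rewrite gtr0_sg ?mul1r.
  by rewrite le_eqVlt (negbTE l0) /= => l; rewrite ltr0_sg ?mulN1r ?mulNr ?opprK.
Qed.

End Multipliers.

(** * Sums of two fold angles *)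

Definition pair_sum {R : realType} (mu nu : R) (t : \bar R) : R :=
  match t with
  | r%:E => 2 * atan (mu * r) + 2 * atan (nu * r)
  | +oo%E => Num.sg mu * pi + Num.sg nu * pi
  | -oo%E => - (Num.sg mu * pi) - Num.sg nu * pi
  end.

Lemma fold_sumE {R : realType} (lam : crease -> R) t i :
  fold_sum (fold_state lam t) i = pair_sum (lam (Tail i)) (lam (Head i)) t.
Proof. by case: t. Qed.

Lemma pair_sumN {R : realType} (mu nu : R) t :
  pair_sum (- mu) (- nu) t = - pair_sum mu nu t.
Proof. by case: t => [r| |] /=; rewrite ?mulNr ?atanN ?sgrN; ring. Qed.

Lemma pair_sum_oppe {R : realType} (mu nu : R) t :
  pair_sum mu nu (- t)%E = - pair_sum mu nu t.
Proof. by case: t => [r| |] /=; rewrite ?mulrN ?atanN; ring. Qed.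

Lemma continuous_pair_sum {R : realType} (mu nu a b : R) :
  {within `[a, b], continuous (fun r => pair_sum mu nu r%:E)}%classic.
Proof.
have cont (c : R) : continuous (fun r : R => 2 * atan (c * r)).
  move=> r; apply: (@continuousM _ R^o (fun=> 2)); first exact: cst_continuous.
  apply: continuous_comp; last exact: continuous_atan.
  exact: mulrl_continuous.
apply: continuous_subspaceT => r.
exact: (continuousD (cont mu r) (cont nu r)).
Qed.

(* When the denominator vanishes, both sides are 0 by the convention x / 0 = 0. *)
Lemma tan_pair_sum {R : realType} (mu nu r : R) :
  tan (pair_sum mu nu r%:E / 2) = (mu + nu) * r / (1 - mu * nu * r ^+ 2).
Proof.
rewrite /pair_sum mulrDl !atan_halfE tanD ?gt_eqF ?cos_atan_gt0 // !atanK.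
by congr (_ / (1 - _)); ring.
Qed.

(** cos (u + v) = cos u cos v (1 - tan u tan v), and cosines of arctangents are positive. *)
Lemma cos_pair_sum_neq0 {R : realType} (mu nu r : R) :
  1 - mu * nu * r ^+ 2 != 0 -> cos (pair_sum mu nu r%:E / 2) != 0.
Proof.
move=> h; rewrite /pair_sum mulrDl !atan_halfE cosD.
have e1 := atanK (mu * r); have e2 := atanK (nu * r).
have := cos_atan_gt0 (mu * r); have := cos_atan_gt0 (nu * r); move: e1 e2; rewrite /tan.
move: (cos (atan (mu * r))) (cos (atan (nu * r)))
  (sin (atan (mu * r))) (sin (atan (nu * r))) => c1 c2 s1 s2 e1 e2 h2 h1.
have e : s1 * s2 = mu * nu * r ^+ 2 * (c1 * c2).
  have -> : mu * nu * r ^+ 2 = (mu * r) * (nu * r) by ring.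
  by rewrite -e1 -e2; field; rewrite !gt_eqF.
rewrite e -[X in X - _]mul1r -mulrBl; apply: mulf_neq0 => //.
by rewrite mulf_neq0 ?gt_eqF.
Qed.

(** Half the sum is 0, pi / 2 or pi up to sign. The value pi / 2 occurs when exactly one multiplier
    vanishes, and there [tan] is 0 by the convention x / 0 = 0. *)
Lemma tan_pair_sum_infty {R : realType} (mu nu : R) :
  tan (pair_sum mu nu +oo%E / 2) = 0 /\ tan (pair_sum mu nu -oo%E / 2) = 0.
Proof.
have -> : pair_sum mu nu -oo%E / 2 = - (pair_sum mu nu +oo%E / 2) by rewrite /=; ring.
suff E : tan (pair_sum mu nu +oo%E / 2) = 0 by rewrite tanN E oppr0.
rewrite /= -mulrDl.
have P (c : R) : (c == 0) || (c == pi / 2) || (c == - (pi / 2)) || (c == pi) || (c == - pi) ->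
    tan c = 0.
  by move=> /orP[/orP[/orP[/orP[]|]|]|] /eqP ->; rewrite ?tanN ?tan0 ?tanpi ?tan_pihalf ?oppr0.
apply: P; case: (sgrP mu) => _; case: (sgrP nu) => _; apply/orP.
all: try by right; apply/eqP; field.
all: left; apply/orP.
all: try by right; apply/eqP; field.
all: left; apply/orP.
all: try by right; apply/eqP; field.
all: left; apply/orP.
all: try by right; apply/eqP; field.
all: by left; apply/eqP; field.
Qed.

(** Intermediate value theorem on [- a, a], with opposite values at the two ends. *)
Lemma pair_sum_onto {R : realType} (mu nu a s : R) : 0 <= a ->
  pair_sum mu nu (- a)%:E = - pair_sum mu nu a%:E ->
  `|s| <= `|pair_sum mu nu a%:E| -> exists r, pair_sum mu nu r%:E = s.
Proof.
move=> a0 odd hs.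
have ab : - a <= a by rewrite ge0_cp.
have [|r _ <-] := @IVT _ _ _ _ s ab (continuous_pair_sum mu nu (- a) a); last by exists r.
rewrite odd ge_min le_max.
move: hs; rewrite ler_norml; case: ler0P => h /andP[h1 h2]; apply/andP; split; apply/orP;
  by [left; lra|right; lra].
Qed.

(** The ends of the interval are reached at the infinite parameters, the values strictly between
    them by continuity at finite ones. *)
Lemma range_pair_sum_same_sign {R : realType} (mu nu : R) : 0 < mu * nu ->
  (range (pair_sum mu nu) = [set s | - (2 * pi) <= s <= 2 * pi])%classic.
Proof.
wlog mu0 : mu nu / 0 < mu.
  move=> hw h; have [mu0|mu0|mu0] := ltgtP mu 0; last by move: h; rewrite mu0 mul0r ltxx.
    rewrite -(hw (- mu) (- nu)) ?oppr_gt0 ?mulrNN //.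
    by apply/seteqP; split=> _ [t _ <-]; exists (- t)%E => //;
      rewrite pair_sum_oppe pair_sumN // opprK.
  exact: hw.
rewrite pmulr_rgt0 // => nu0; have p0 := pi_gt0 R.
have B (x : R) : - pi < 2 * atan x < pi.
  by have := atan_gtNpi2 x; have := atan_ltpi2 x; lra.
apply/seteqP; split=> [_ [t _ <-]|s /=].
  case: t => [r| |] /=; last 2 first.
  - by rewrite !gtr0_sg //; lra.
  - by rewrite !gtr0_sg //; lra.
  by have := B (mu * r); have := B (nu * r); lra.
move=> /andP[]; rewrite [_ <= s]le_eqVlt => /predU1P[<- _|s1].
  by exists -oo%E => //=; rewrite !gtr0_sg //; ring.
rewrite le_eqVlt => /predU1P[->|s2].
  by exists +oo%E => //=; rewrite !gtr0_sg //; ring.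
(* The slower of the two creases already contributes |s| / 2 at a. *)
pose a := tan (`|s| / 4) / Num.min mu nu.
have m0 : 0 < Num.min mu nu by rewrite lt_min mu0.
have sr : 0 <= `|s| / 4 < pi / 2.
  rewrite divr_ge0 //=; have : `|s| < 2 * pi by rewrite ltr_norml s1. lra.
have T0 : 0 <= tan (`|s| / 4).
  by rewrite /tan divr_ge0 // ?sin_ge0_pi ?cos_ge0_pihalf //; lra.
have a0 : 0 <= a by rewrite divr_ge0 // ltW.
have mono (c : R) : Num.min mu nu <= c -> `|s| / 4 <= atan (c * a).
  move=> hc; have <- : atan (tan (`|s| / 4)) = `|s| / 4.
    by apply: tanK; rewrite in_itv /=; lra.
  by apply: le_atan; rewrite /a mulrA ler_pdivlMr // [leLHS]mulrC ler_wpM2r.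
have [] := @pair_sum_onto _ mu nu a s a0.
- exact: (pair_sum_oppe mu nu a%:E).
- have := mono mu; have := mono nu; rewrite !ge_min !lexx orbT => /(_ isT) h1 /(_ isT) h2.
  by rewrite /= [leRHS]ger0_norm; lra.
by move=> r <-; exists r%:E.
Qed.

Lemma normr_atan {R : realType} (x : R) : `|atan x| = atan `|x|.
Proof.
have [x0|x0] := ler0P x; last by rewrite gtr0_norm // -atan0 lt_atan.
by rewrite atanN ler0_norm // -atan0 le_atan.
Qed.

(** The two fold angles never have the same strict sign, and each is less than pi in absolute value.
    Half the sum thus stays where [atan] inverts [tan]. *)
Lemma pair_sum_opposite_lt_pi {R : realType} (mu nu r : R) : mu * nu < 0 ->
  `|pair_sum mu nu r%:E| < pi.
Proof.
move=> h; rewrite ltr_norml /=.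
have := atan_gtNpi2 (mu * r); have := atan_ltpi2 (mu * r).
have := atan_gtNpi2 (nu * r); have := atan_ltpi2 (nu * r).
have [m0|m0] := lerP 0 (mu * r).
  have n0 : nu * r <= 0 by nra.
  have := le_atan n0; have := le_atan m0; rewrite atan0; lra.
have n0 : 0 <= nu * r by nra.
have := le_atan n0; have := le_atan (ltW m0); rewrite atan0; lra.
Qed.

(** Since [atan] is monotone, maximizing the sum reduces to maximizing |r| / (1 - mu nu r^2). *)
Lemma norm_pair_sum_opposite {R : realType} (mu nu r : R) : mu * nu < 0 ->
  `|pair_sum mu nu r%:E| = 2 * atan (`|mu + nu| * (`|r| / (1 - mu * nu * r ^+ 2))).
Proof.
move=> h; have lt_pi := pair_sum_opposite_lt_pi mu nu r h.
have d0 : 0 <= 1 - mu * nu * r ^+ 2 by nra.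
rewrite -[in RHS](ger0_norm d0) -normfV -!normrM -normr_atan mulrA -tan_pair_sum.
rewrite tanK; last by move: lt_pi; rewrite ltr_norml in_itv /=; lra.
by rewrite normrM normfV [`|2|]ger0_norm //; field.
Qed.

Lemma range_pair_sum_opposite_sign {R : realType} (mu nu : R) : mu * nu < 0 ->
  exists2 M, 0 <= M < pi &
    (range (pair_sum mu nu) = [set s | - M <= s <= M])%classic.
Proof.
move=> h; have c0 : 0 < - (mu * nu) by rewrite oppr_gt0.
(* The parameter at which |r| / (1 - mu nu r^2) is largest. *)
pose a := (Num.sqrt (- (mu * nu)))^-1.
have a0 : 0 < a by rewrite invr_gt0 sqrtr_gt0.
have ka : mu * nu * a ^+ 2 = - 1.
  rewrite exprVn sqr_sqrtr ?ltW // invrN mulrN divff //; exact: ltr0_neq0.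
exists `|pair_sum mu nu a%:E|; first by rewrite normr_ge0 pair_sum_opposite_lt_pi.
apply/seteqP; split=> [_ [t _ <-]|s /=]; last first.
  rewrite -ler_norml => hs.
  have [|r <-] := @pair_sum_onto _ mu nu a s (ltW a0) _ hs; last by exists r%:E.
  exact: (pair_sum_oppe mu nu a%:E).
rewrite /= -ler_norml.
have sg0 : Num.sg mu * pi + Num.sg nu * pi = 0 :> R.
  by move: h; case: (sgrP mu) => m0; case: (sgrP nu) => n0 h; try (by field); nra.
case: t => [r| |] /=; last 2 first.
- by rewrite sg0 normr0.
- by rewrite -opprD sg0 oppr0 normr0.
rewrite !norm_pair_sum_opposite // ler_pM2l //; apply: le_atan.
rewrite ler_wpM2l // ka [`|a|]gtr0_norm // ler_pdivrMr; last by nra.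
(* Multiplied by [a], the claim becomes |r| a <= (a^2 + |r|^2) / 2. *)
rewrite -(ler_pM2r a0) -real_normK ?num_real //.
have -> : a / (1 - -1) * (1 - mu * nu * `|r| ^+ 2) * a
  = (a ^+ 2 - mu * nu * a ^+ 2 * `|r| ^+ 2) / 2 by field.
have := sqr_ge0 (`|r| - a); rewrite ka; lra.
Qed.

(** * The modes of the double-line pattern *)

Lemma p_bounds {R : realType} (x y : R) : 0 < x < pi -> 0 < y < pi -> - 1 < p x y < 1.
Proof.
move=> /tan_half_gt0 u0 /tan_half_gt0 v0.
have d : 0 < 1 + tan (x / 2) * tan (y / 2) by nra.
by rewrite /p ltr_pdivlMr // ltr_pdivrMr //; nra.
Qed.

Lemma tan_half_lt {R : realType} (x y : R) : 0 < x < pi -> 0 < y < pi ->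
  (tan (x / 2) < tan (y / 2)) = (x < y).
Proof.
by move=> hx hy; rewrite ltr_tan ?in_itv /=; [rewrite ltr_pM2r|lra|lra].
Qed.

(** As tan ((pi - y) / 2) is the inverse of tan (y / 2), comparing x with pi - y amounts to
    comparing tan (x / 2) tan (y / 2) with 1. *)
Lemma p_gt0 {R : realType} (x y : R) : 0 < x < pi -> 0 < y < pi -> x < pi - y -> 0 < p x y.
Proof.
move=> hx hy h; have hy' : 0 < pi - y < pi by lra.
have u0 := tan_half_gt0 _ hx; have v0 := tan_half_gt0 _ hy.
have {}h : tan (x / 2) * tan (y / 2) < 1.
  by rewrite -ltr_pdivlMr // div1r -tan_half_pi_sub tan_half_lt.
by rewrite /p divr_gt0; nra.
Qed.

Lemma p_lt0 {R : realType} (x y : R) : 0 < x < pi -> 0 < y < pi -> pi - y < x -> p x y < 0.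
Proof.
move=> hx hy h; have hy' : 0 < pi - y < pi by lra.
have u0 := tan_half_gt0 _ hx; have v0 := tan_half_gt0 _ hy.
have {}h : 1 < tan (x / 2) * tan (y / 2).
  by rewrite -ltr_pdivrMr // div1r -tan_half_pi_sub tan_half_lt.
by rewrite /p pmulr_llt0 ?invr_gt0; nra.
Qed.

(** The subtraction formula of tanh: (1 - z) / (1 + z) = tanh (- ln z / 2), and with z = tan (theta
    / 2) tan (a / 2) the contribution of theta to ln z cancels in the difference. *)
Lemma p_subE {R : realType} (theta a b : R) :
  0 < theta < pi -> 0 < a < pi -> 0 < b < pi ->
  p theta b - p theta a = (tan (a / 2) - tan (b / 2)) / (tan (a / 2) + tan (b / 2))
    * (1 - p theta a * p theta b).
Proof.
move=> /tan_half_gt0 t0 /tan_half_gt0 a0 /tan_half_gt0 b0; rewrite /p.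
move: t0 a0 b0; move: (tan (theta / 2)) (tan (a / 2)) (tan (b / 2)) => u v w u0 v0 w0.
by field; rewrite !gt_eqF //; nra.
Qed.

(** The ratio of tan (S_k / 2) to tan (S_(k+1) / 2) in the corresponding mode of V, for k =
    [start m]. *)
Definition mode_ratio {R : realType} (alpha beta : R) (m : DL_mode) : R :=
  match m with
  | aI => p alpha beta | aII => - p alpha beta
  | bI => q alpha beta | bII => - q alpha beta
  end.

Lemma mode_ratioE {R : realType} (alpha beta : R) (m : DL_mode) :
  0 < alpha < pi -> 0 < beta < pi ->
  let a := tan (sector alpha beta (start m) / 2) in
  let b := tan (sector alpha beta (start m + 1) / 2) in
  (a - b) / (a + b) = mode_ratio alpha beta m.
Proof.
move=> /tan_half_gt0 a0 /tan_half_gt0 b0.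
case: m; rewrite /sector /= ?tan_half_pi_sub /p /q;
  move: (tan (alpha / 2)) (tan (beta / 2)) a0 b0 => v w v0 w0;
  by field; rewrite !gt_eqF //; nra.
Qed.

Section Motion.
Variables (R : realType) (alpha beta theta : R) (D : pattern R) (m : DL_mode).
Hypotheses (ha : 0 < alpha < pi) (hb : 0 < beta < pi) (ht : 0 < theta < pi).
Hypothesis hD : is_DL alpha beta theta D.
Let k := start m.
Let x := p theta (sector alpha beta k).
Let y := p theta (sector alpha beta (k + 1)).
Let lam := multiplier k x y.

Lemma S_values_range i :
  S_values alpha beta theta D m i = range (pair_sum (lam (Tail i)) (lam (Head i))).
Proof.
apply/seteqP; split=> [_ [rho hrho <-]|_ [t _ <-]].
  have [t ->] := (full_motionE _ _ _ _ m ha hb ht D rho hD).1 hrho.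
  by exists t => //; rewrite fold_sumE.
exists (fold_state lam t); last by rewrite fold_sumE.
by apply/(full_motionE _ _ _ _ m ha hb ht D _ hD); exists t.
Qed.

Lemma spans_full_of : x * y < 0 -> spans_full alpha beta theta D m.
Proof.
move=> h i; rewrite S_values_range; apply: range_pair_sum_same_sign.
by rewrite multiplierM oppr_gt0.
Qed.

Lemma spans_less_of : 0 < x * y -> spans_less_than_pi alpha beta theta D m.
Proof.
move=> h i; rewrite S_values_range; apply: range_pair_sum_opposite_sign.
by rewrite multiplierM oppr_lt0.
Qed.

(** Read from [start m] on, the pattern r, 1, - r, 1 is the Mode a vector when the start is odd
    (a-I, a-II) and the Mode b vector when it is even (b-I, b-II). *)
Lemma tan_fold_sum rho (r := mode_ratio alpha beta m) :
  full_motion alpha beta theta D m rho ->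
  exists w, [/\ tan (fold_sum rho k / 2) = r * w, tan (fold_sum rho (k + 1) / 2) = w,
    tan (fold_sum rho (k + 1 + 1) / 2) = - r * w
  & tan (fold_sum rho (k + 1 + 1 + 1) / 2) = w].
Proof.
move=> /(full_motionE _ _ _ _ m ha hb ht D _ hD) [t ->].
have [_ [T0 T1 T2 T3] [H0 H1 H2 H3]] := multiplierE k x y.
have yx : y - x = r * (1 - x * y).
  by rewrite p_subE ?sector_range // mode_ratioE.
have xy : x - y = - r * (1 - x * y) by rewrite mulNr -yx opprB.
rewrite !fold_sumE T0 T1 T2 T3 H0 H1 H2 H3.
case: t => [t| |]; last 2 first.
- by exists 0; rewrite !mulr0 !(tan_pair_sum_infty _ _).1.
- by exists 0; rewrite !mulr0 !(tan_pair_sum_infty _ _).2.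
(* The tangent of S_(k+1) / 2; all four pairs share its denominator since their multipliers have
   product - x y. *)
exists ((1 - x * y) * (t / (1 + x * y * t ^+ 2))).
rewrite !tan_pair_sum (mulrA r) (mulrA (- r)) -yx -xy.
by split; rewrite [RHS]mulrA; congr (_ * _ / _); ring.
Qed.

Lemma xy_bounds : 0 < 1 - x * y /\ 0 < 1 + x * y.
Proof.
have := p_bounds theta (sector alpha beta k) ht (sector_range _ _ _ ha hb).
have := p_bounds theta (sector alpha beta (k + 1)) ht (sector_range _ _ _ ha hb).
by rewrite -/x -/y; nra.
Qed.

(** This state, at t = 1, excludes the other mode of V, which would make the tangents at k + 1 and k
    + 3 opposite. *)
Lemma generic_fold_sum : exists rho, [/\ full_motion alpha beta theta D m rho,
  forall i, cos (fold_sum rho i / 2) != 0 & exists w, w != 0 /\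
    tan (fold_sum rho (k + 1) / 2) = w /\ tan (fold_sum rho (k + 1 + 1 + 1) / 2) = w].
Proof.
have [b1 b2] := xy_bounds.
exists (fold_state lam 1%:E); split.
- by apply/(full_motionE _ _ _ _ m ha hb ht D _ hD); exists 1%:E.
- move=> i; rewrite fold_sumE; apply: cos_pair_sum_neq0.
  by rewrite multiplierM expr1n mulr1 opprK gt_eqF.
exists ((1 - x * y) / (1 + x * y)).
split; first by rewrite mulf_neq0 ?invr_eq0 ?gt_eqF.
have [_ [T0 T1 T2 T3] [H0 H1 H2 H3]] := multiplierE k x y.
rewrite !fold_sumE /lam T1 T3 H1 H3 !tan_pair_sum.
by split; congr (_ / _); ring.
Qed.

End Motion.

Theorem theorem2 (R : realType) (alpha beta theta : R)
  (halpha : 0 < alpha < pi) (hbeta : 0 < beta < pi) (htheta : 0 < theta < pi)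
  (D : pattern R) (hD : is_DL alpha beta theta D) :
  ((forall m : DL_mode,
      corresponds (V_mode_a alpha beta) (full_motion alpha beta theta D m)
        <-> (m = aI \/ m = aII)) /\
   (forall m : DL_mode,
      corresponds (V_mode_b alpha beta) (full_motion alpha beta theta D m)
        <-> (m = bI \/ m = bII))) /\
  (0 < alpha -> alpha < beta -> beta < pi / 2 ->
    [/\ (beta < theta < pi - alpha -> spans_full alpha beta theta D aI) /\
        ((theta < pi - alpha /\ theta < beta) \/
         (pi - alpha < theta /\ beta < theta) ->
         spans_less_than_pi alpha beta theta D aI),
        (alpha < theta < pi - beta -> spans_full alpha beta theta D aII) /\
        ((theta < pi - beta /\ theta < alpha) \/
         (pi - beta < theta /\ alpha < theta) ->
         spans_less_than_pi alpha beta theta D aII),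
        (alpha < theta < beta -> spans_full alpha beta theta D bI) /\
        ((theta < alpha /\ theta < beta) \/
         (alpha < theta /\ beta < theta) ->
         spans_less_than_pi alpha beta theta D bI)
      & (pi - beta < theta < pi - alpha -> spans_full alpha beta theta D bII) /\
        ((theta < pi - alpha /\ theta < pi - beta) \/
         (pi - alpha < theta /\ pi - beta < theta) ->
         spans_less_than_pi alpha beta theta D bII)]).
Proof.
have modeA (m : DL_mode) : m = aI \/ m = aII ->
    corresponds (V_mode_a alpha beta) (full_motion alpha beta theta D m).
  move=> hm rho /(tan_fold_sum _ _ _ _ _ _ halpha hbeta htheta hD) [w [t0 t1 t2 t3]] _.
  exists w; elim/(@I4_shift_ind (start m)); rewrite ?t0 ?t1 ?t2 ?t3;
    by case: hm => -> /=; rewrite ?opprK ?mul1r.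
have modeB (m : DL_mode) : m = bI \/ m = bII ->
    corresponds (V_mode_b alpha beta) (full_motion alpha beta theta D m).
  move=> hm rho /(tan_fold_sum _ _ _ _ _ _ halpha hbeta htheta hD) [w [t0 t1 t2 t3]] _.
  exists w; elim/(@I4_shift_ind (start m)); rewrite ?t0 ?t1 ?t2 ?t3;
    by case: hm => -> /=; rewrite ?opprK ?mul1r.
have opp (w c tau : R) : w != 0 -> w = c * tau -> w = - c * tau -> False.
  by move=> /eqP w0 e1 e2; apply: w0; lra.
split; first split.
- move=> m; split; last exact: modeA.
  have [rho [hrho hcos [w [w0 [t1 t3]]]]] := generic_fold_sum _ _ _ _ _ m halpha hbeta htheta hD.
  move=> /(_ rho hrho hcos) [tau h]; case: m t1 t3 hrho => t1 t3 hrho;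
    [by left|by right|exfalso|exfalso].
  + by apply: (opp _ _ _ w0); [rewrite -t1 h|rewrite -t3 h].
  + by apply: (opp _ _ _ w0); [rewrite -t3 h|rewrite -t1 h].
- move=> m; split; last exact: modeB.
  have [rho [hrho hcos [w [w0 [t1 t3]]]]] := generic_fold_sum _ _ _ _ _ m halpha hbeta htheta hD.
  move=> /(_ rho hrho hcos) [tau h]; case: m t1 t3 hrho => t1 t3 hrho;
    [exfalso|exfalso|by left|by right].
  + by apply: (opp _ _ _ w0); [rewrite -t3 h|rewrite -t1 h].
  + by apply: (opp _ _ _ w0); [rewrite -t1 h|rewrite -t3 h].
move=> _ _ _.
have pos i : theta < pi - sector alpha beta i -> 0 < p theta (sector alpha beta i).
  by apply: p_gt0 => //; exact: sector_range.
have neg i : pi - sector alpha beta i < theta -> p theta (sector alpha beta i) < 0.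
  by apply: p_lt0 => //; exact: sector_range.
(* x changes sign at theta = pi - s and y at theta = pi - s', so x y < 0 when theta lies strictly
   between these thresholds. *)
have full m (s := sector alpha beta (start m)) (s' := sector alpha beta (start m + 1)) :
    theta < pi - s /\ pi - s' < theta \/ pi - s < theta /\ theta < pi - s' ->
    spans_full alpha beta theta D m.
  move=> h; apply: spans_full_of => //.
  by case: h => -[]; [move=> /pos h /neg h'|move=> /neg h /pos h']; nra.
have less m (s := sector alpha beta (start m)) (s' := sector alpha beta (start m + 1)) :
    theta < pi - s /\ theta < pi - s' \/ pi - s < theta /\ pi - s' < theta ->
    spans_less_than_pi alpha beta theta D m.
  move=> h; apply: spans_less_of => //.
  by case: h => -[]; [move=> /pos h /pos h'|move=> /neg h /neg h']; nra.
(* The thresholds are beta and pi - alpha for a-I, pi - beta and alpha for a-II, alpha and beta for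
   b-I, pi - alpha and pi - beta for b-II. *)
split; split=> [/andP[h1 h2]|h].
- by apply: full; rewrite /sector /=; right; split; lra.
- by apply: less; rewrite /sector /=; case: h => -[h1 h2]; [left|right]; split; lra.
- by apply: full; rewrite /sector /=; left; split; lra.
- by apply: less; rewrite /sector /=; case: h => -[h1 h2]; [left|right]; split; lra.
- by apply: full; rewrite /sector /=; right; split; lra.
- by apply: less; rewrite /sector /=; case: h => -[h1 h2]; [left|right]; split; lra.
- by apply: full; rewrite /sector /=; left; split; lra.
- by apply: less; rewrite /sector /=; case: h => -[h1 h2]; [left|right]; split; lra.
Qed.
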